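(* Let $(X,d)$ be a metric space (not necessarily complete), let $F:X\to(-\infty,+\infty]$ be a lower semicontinuous functional, bounded from below, whose proper domain $D(F)=\{w\in X:F(w)<+\infty\}$ is dense in $X$, and let $\lambda\in\mathbb{R}$. Suppose that $\mathsf{S}$ is a $\lambda$-flow for $F$, and let $\gamma:[0,1]\to X$ be a Lipschitz curve satisfying $$d(\gamma^r,\gamma^s)\le L|r-s|\quad\text{for all }r,s\in[0,1],\qquad L^2\le d^2(\gamma^0,\gamma^1)+\varepsilon^2,$$ for some constants $L\ge 0$ and $\varepsilon\ge0$. Then for every $t>0$ and $s\in[0,1]$ $$F(\mathsf{S}_t(\gamma^s))\le(1-s)F(\gamma^0)+sF(\gamma^1)-\frac\lambda2s(1-s)d^2(\gamma^0,\gamma^1)+\frac{\varepsilon^2}{2\mathsf{E}_\lambda(t)}s(1-s),$$ where $\mathsf{E}_\lambda(t):=\int_0^te^{\lambda r}\,dr$. In particular, when $\gamma$ is a geodesic (i.e. $d(\gamma^r,\gamma^s)\le L|r-s|$ for all $r,s\in[0,1]$ with $L=d(\gamma^0,\gamma^1)$, so that one can take $\varepsilon=0$), then for every $s\in[0,1]$ $$F(\gamma^s)\le(1-s)F(\gamma^0)+sF(\gamma^1)-\frac\lambda2s(1-s)d^2(\gamma^0,\gamma^1),$$ i.e. $F$ is (strongly) geodesically $\lambda$-convex.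
   Context: A $C^0$-semigroup on $X$ is a family $\mathsf{S}_t:X\to X$, $t\ge0$, of continuous maps with $\mathsf{S}_{t+h}(u)=\mathsf{S}_h(\mathsf{S}_t(u))$ and $\lim_{t\downarrow0}\mathsf{S}_t(u)=\mathsf{S}_0(u)=u$ for all $u\in X$, $t,h\ge0$. It is a $\lambda$-flow for $F$ if: (a) $\mathsf{S}_t(X)\subset D(F)$ for every $t>0$; (b) for every $u\in X$ the map $t\mapsto F(\mathsf{S}_t(u))$ is non-increasing on $(0,+\infty)$; (c) $\frac12\frac{d^+}{dt}d^2(\mathsf{S}_t(u),v)+\frac\lambda2d^2(\mathsf{S}_t(u),v)+F(\mathsf{S}_t(u))\le F(v)$ for all $u\in X$, $v\in D(F)$, $t\ge0$, where $\frac{d^+}{dt}\zeta(t)=\limsup_{h\downarrow0}\frac{\zeta(t+h)-\zeta(t)}h$. When $t=0$ and $F(u)=+\infty$, (c) is understood with $F(\mathsf{S}_t(u))$ moved to the right-hand side, i.e. $\frac{d^+}{dt}d^2(\mathsf{S}_t(u),v)|_{t=0}=-\infty$. The convention $0\cdot(+\infty)=0$ is used in the convexity inequalities. *)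

(* Defs.v *)
From mathcomp Require Import all_boot all_order all_algebra.
From mathcomp Require Import all_classical all_reals all_analysis.

Set Implicit Arguments.
Unset Strict Implicit.
Unset Printing Implicit Defensive.

Import Order.TTheory GRing.Theory Num.Theory.
Import numFieldNormedType.Exports.

Local Open Scope classical_set_scope.
Local Open Scope ring_scope.

Definition proper_domain (R : realType) (X : Type) (F : X -> \bar R) : set X :=
  [set w | (F w < +oo)%E].

Definition upper_right_derivative (R : realType) (zeta : R -> R) (t : R) :
    \bar R :=
  limf_esup (fun h : R => ((zeta (t + h) - zeta t) / h)%:E) (0 : R)^'+.

(* The time index ranges over all of R, but only S t with 0 <= t is
   constrained or used. *)
Record C0_semigroup (R : realType) (X : metricType R) (S : R -> X -> X) :
    Prop := {
  C0_semigroup_continuous : forall t : R, 0 <= t -> continuous (S t) ;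
  C0_semigroupD : forall (t h : R) u, 0 <= t -> 0 <= h -> S (t + h) u = S h (S t u) ;
  C0_semigroup_cvg0 : forall u, S t u @[t --> 0^'+] --> S 0 u ;
  C0_semigroup0 : forall u, S 0 u = u }.

(* The evolution variational inequality is split according to the finiteness
   of F (S t u), so that no sum -oo + +oo has to be interpreted: the case
   F (S t u) = +oo can only occur at t = 0, where S 0 u = u. *)
Record lambda_flow (R : realType) (X : metricType R) (F : X -> \bar R)
    (lambda : R) (S : R -> X -> X) : Prop := {
  lambda_flow_semigroup : C0_semigroup S ;
  lambda_flow_domain : forall (t : R) u, 0 < t -> proper_domain F (S t u) ;
  lambda_flow_nonincreasing : forall u,
    {in `]0, +oo[ &, nonincreasing_fun (fun t => F (S t u))} ;
  lambda_flow_EVI : forall u v (t : R),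
    proper_domain F v -> 0 <= t -> proper_domain F (S t u) ->
    ((2^-1)%:E
        * upper_right_derivative (fun r => mdist (S r u) v ^+ 2)%R t
      + (lambda / 2 * mdist (S t u) v ^+ 2)%:E + F (S t u) <= F v)%E ;
  lambda_flow_EVI0 : forall u v,
    proper_domain F v -> F u = +oo%E ->
    upper_right_derivative (fun r => mdist (S r u) v ^+ 2) 0 = -oo%E }.

Definition E_ (R : realType) (lambda t : R) : R :=
  \int[lebesgue_measure]_(r in `[0, t]) expR (lambda * r).

(* Curves on [0, 1] are represented by functions on R, whose values outside
   [0, 1] are irrelevant. *)
Definition lipschitz_curve (R : realType) (X : metricType R) (L : R)
    (gamma : R -> X) : Prop :=
  {in `[0, 1] &, forall r s, mdist (gamma r) (gamma s) <= L * `|r - s|}.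

Definition geodesic (R : realType) (X : metricType R) (gamma : R -> X) : Prop :=
  lipschitz_curve (mdist (gamma 0) (gamma 1)) gamma.

(* In \bar R, 0 * +oo = 0, as required at s = 0 and s = 1. *)
Definition strongly_geodesically_convex (R : realType) (X : metricType R)
    (lambda : R) (F : X -> \bar R) : Prop :=
  forall gamma : R -> X, geodesic gamma ->
  {in `[0, 1], forall s,
    (F (gamma s) <= (1 - s)%:E * F (gamma 0%R) + s%:E * F (gamma 1%R)
       - (lambda / 2 * s * (1 - s) * mdist (gamma 0%R) (gamma 1%R) ^+ 2)%:E)%E}.

(* Main.v *)
Require Import Defs.
From mathcomp Require Import all_boot all_order all_algebra.
From mathcomp Require Import all_classical all_reals all_analysis.
From mathcomp Require Import ring lra.

Import Order.TTheory GRing.Theory Num.Theory.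
Import numFieldNormedType.Exports.

Local Open Scope classical_set_scope.
Local Open Scope ring_scope.

(** The evolution variational inequality bounds the growth of the squared
    distance from the flow to a fixed point v. Multiplied by e^(lambda r) and
    integrated over [0, t], with the energy frozen at its smallest value
    F (S t u), it becomes the purely metric estimate [integrated_EVI]:
      e^(lambda t) d^2(S_t u, v) - d^2(u, v)
        <= 2 E_lambda(t) (F(v) - F(S_t u)).
    Write it for u = gamma s with v = gamma 0 and with v = gamma 1, and take
    the combination with weights 1 - s and s. The distances from S_t (gamma s)
    to the two ends are bounded below by the triangle inequality, through
      (1 - s) a^2 + s b^2 >= s (1 - s) (a + b)^2,
    and the distances from gamma s to them are bounded above by the Lipschitz
    condition. What remains is the perturbed convexity inequality
    ([convexity_from_EVI]). On a geodesic the perturbation vanishes, and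
    letting t decrease to 0 gives convexity of F by lower semicontinuity.

    Integrating an inequality between upper right Dini derivatives is only
    legitimate for continuous functions: an upward jump from the left would be
    invisible to right derivatives. The semigroup axioms directly give only
    continuity of the orbits from the right. Left continuity is recovered by a
    Baire argument: a right continuous map has a dense set of continuity
    points, and continuity of an orbit at a time c propagates to every later
    time t, because S_(t - c) is continuous
    ([C0_semigroup_orbit_continuous]). *)

(** * Continuity of the orbits of a semigroup *)

(** Baire's theorem applies to the open sets of points having a neighbourhood
    on which f oscillates by less than 1 / (n + 1). They are dense because,
    by right continuity, f varies little on some interval starting at any
    given point. *)
Lemma right_continuous_dense_continuity_points {R : realType}
    {X : metricType R} {f : R -> X} :
  (forall t, f x @[x --> t^'+] --> f t) ->
  dense [set t | {for t, continuous f}].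
Proof.
move=> fr.
pose U (n : nat) : set R^o := [set t | exists V : set R^o, [/\ open V, V t &
  forall x y, V x -> V y -> mdist (f x) (f y) < n.+1%:R^-1]].
have UP n : open (U n) /\ dense (U n).
  split.
    rewrite openE => t [V [oV Vt hV]].
    by apply: (@filterS _ _ _ V); [move=> x Vx; exists V | exact: open_nbhs_nbhs].
  move=> D [t0 Dt0] oD.
  have e0 : 0 < n.+1%:R^-1 / 2 :> R by rewrite divr_gt0// invr_gt0.
  have /nbhs_right0P[/= e egt0 he] : \forall x \near t0^'+,
      D x /\ mdist (f t0) (f x) < n.+1%:R^-1 / 2.
    apply: filterI; last exact: metricType_numDomainType.cvgr_dist_lt (fr t0) _ e0.
    by apply: cvg_within; apply: open_nbhs_nbhs.
  have {}he x : t0 < x < t0 + e -> D x /\ mdist (f t0) (f x) < n.+1%:R^-1 / 2.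
    move=> /andP[h1 h2]; rewrite -(subrK t0 x) addrC; apply: he => /=.
      by rewrite sub0r normrN gtr0_norm ?subr_gt0// ltrBlDl.
    by rewrite subr_gt0.
  have h2 : t0 < t0 + e / 2 < t0 + e by move: egt0 => /= ?; lra.
  exists (t0 + e / 2); split; first by case: (he _ h2).
  exists `]t0, t0 + e[%classic; split => [||x y].
  - exact: interval_open.
  - by rewrite /= in_itv.
  - rewrite /= !in_itv /= => /he[_ hx] /he[_ hy].
    rewrite (le_lt_trans (metric_triangle _ (f t0) _))// (metric_sym (f x)).
    by rewrite [ltRHS]splitr ltrD.
have /= hB := Baire UP.
move=> D D0 oD; have [t [Dt Ut]] := hB D D0 oD.
exists t; split => //=; apply/metricType_numDomainType.cvgrPdist_lt => e e0.
have [n _ /(_ n (leqnn n)) ne] := near_infty_natSinv_lt (PosNum e0).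
have [V [oV Vt hV]] := Ut n I.
apply: (@filterS _ (nbhs t) _ V); last exact: open_nbhs_nbhs.
by move=> x Vx; rewrite (lt_trans (hV _ _ Vt Vx)).
Qed.

Lemma C0_semigroup_right_continuous {R : realType} {X : metricType R}
    {S : R -> X -> X} (u : X) (t : R) :
  C0_semigroup S -> 0 <= t -> S r u @[r --> t^'+] --> S t u.
Proof.
move=> hS t0; apply/metricType_numDomainType.cvgrPdist_lt => e e0; apply/nbhs_right0P.
have := metricType_numDomainType.cvgr_dist_lt (C0_semigroup_cvg0 hS (u := S t u)) e0.
rewrite (C0_semigroup0 hS) => h; near=> k.
have k0 : 0 <= k by near: k; exact: nbhs_right_ge.
by rewrite (C0_semigroupD hS)//; near: k; exact: h.
Unshelve. all: by end_near. Qed.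

(** The orbit has a continuity point c in ]0, t[, and for x near t one has
    S_x u = S_(t - c) (S_(x - (t - c)) u) with x - (t - c) close to c. *)
Lemma C0_semigroup_orbit_continuous {R : realType} {X : metricType R}
    {S : R -> X -> X} (u : X) (t : R) :
  C0_semigroup S -> 0 < t -> {for t, continuous (S^~ u)}.
Proof.
move=> hS t0.
(* Frozen at negative times, the orbit is right continuous on the whole line. *)
pose f r := S (Num.max r 0) u.
have fE r : 0 <= r -> f r = S r u by move=> r0; rewrite /f max_l.
have fr r : f x @[x --> r^'+] --> f r.
  have [r0|r0] := leP 0 r.
    rewrite fE//.
    have := C0_semigroup_right_continuous u r hS r0; apply: cvg_trans.
    apply: near_eq_cvg; near=> x; rewrite fE//.
    by apply: le_trans r0 _; near: x; exact: nbhs_right_ge.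
  apply: cvg_near_cst; near=> x; have x0 : x < 0 by near: x; exact: nbhs_right_lt.
  by rewrite /f !max_r ?ltW.
have [c [c0 ct fc]] : exists c : R, [/\ 0 < c, c < t & {for c, continuous f}].
  have [||c []] := right_continuous_dense_continuity_points fr `]0, t[%classic.
  - by exists (t / 2); rewrite /= in_itv /=; lra.
  - exact: interval_open.
  - by rewrite /= in_itv /= => /andP[c0 ct] fc; exists c.
have tc : 0 <= t - c by lra.
have fcE : S (t - c) (f c) = S t u.
  by rewrite fE ?(ltW c0)// -(C0_semigroupD hS _ (ltW c0) tc) addrC subrK.
suff : S r u @[r --> t] --> S (t - c) (f c) by rewrite fcE.
have sh : (x - (t - c)) @[x --> t] --> c.
  rewrite [X in _ --> X](_ : c = t - (t - c)); last by ring.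
  by apply: cvgB; [exact: cvg_id | exact: cvg_cst].
have ffc : f (x - (t - c)) @[x --> t] --> f c by exact: cvg_comp sh fc.
have Sc : S (t - c) x @[x --> f c] --> S (t - c) (f c).
  exact: (C0_semigroup_continuous hS tc).
have := cvg_comp _ _ ffc Sc; apply: cvg_trans.
apply: near_eq_cvg; near=> x => /=.
have xtc : 0 <= x - (t - c).
  rewrite subr_ge0 ltW//; near: x; apply: lt_nbhsr; lra.
by rewrite fE// -(C0_semigroupD hS)// subrK.
Unshelve. all: by end_near. Qed.

(** * Differential inequalities in the sense of Dini *)

(** It suffices to bound f b by f a + e (b - a) for every e > 0. The set of
    points x where the analogous bound at x holds is closed by continuity,
    and the hypothesis at its supremum would extend it beyond, unless the
    supremum is b. *)
Lemma Dini_nonincreasing {R : realType} (f : R -> R) (a b : R) :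
  a <= b ->
  {in `[a, b], continuous f} ->
  (forall x, a <= x < b -> forall e, 0 < e ->
     \forall h \near 0^'+, f (x + h) <= f x + e * h) ->
  f b <= f a.
Proof.
move=> ab cf Df; apply/ler_addgt0Pr => e0 e0gt0.
(* The added 1 keeps the denominator positive when a = b. *)
pose e := e0 / (b - a + 1).
have ba1 : 0 < b - a + 1 by lra.
have egt0 : 0 < e by rewrite divr_gt0.
pose A := [set x | a <= x <= b /\ f x <= f a + e * (x - a)].
have Aa : A a by rewrite /A /= lexx ab subrr mulr0 addr0.
have hA : has_sup A by split; [exists a | exists b => x [/andP[]]].
have Asup : a <= sup A <= b.
  apply/andP; split; first by apply: ub_le_sup => //; case: hA.
  by apply: ge_sup; [exists a | move=> x [/andP[]]].
have fsup : f (sup A) <= f a + e * (sup A - a).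
  rewrite leNgt; apply/negP => h.
  have cg : (f x - (f a + e * (x - a))) @[x --> sup A] -->
            f (sup A) - (f a + e * (sup A - a)).
    apply: cvgB; first by apply: cf; rewrite in_itv.
    apply: cvgD; first exact: cvg_cst.
    apply: cvgM; first exact: cvg_cst.
    by apply: cvgB; [exact: cvg_id | exact: cvg_cst].
  have /nbhs_ballP[d /= d0 hd] : \forall x \near sup A, 0 < f x - (f a + e * (x - a)).
    by apply: (cvgr_gt _ cg); rewrite subr_gt0.
  have [x [xab fx] xs] := sup_adherent d0 hA.
  have := hd x; rewrite /ball /= => /(_ _)/wrap[]; last by rewrite subr_gt0 ltNge fx.
  rewrite ger0_norm; first lra.
  by rewrite subr_ge0 ub_le_sup//; case: hA.
have [sb|sb] := ltP (sup A) b; last first.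
  have sE : sup A = b by apply/eqP; rewrite eq_le sb andbT; case/andP: Asup.
  rewrite -sE (le_trans fsup)// lerD2l sE /e mulrAC ler_pdivrMr//.
  by rewrite ler_pM2l//; lra.
exfalso.
have := Df (sup A); rewrite sb andbT => /(_ _ e egt0)/wrap[].
  by case/andP: Asup.
move=> hh; near (0 : R)^'+ => h.
have h0 : 0 < h by [].
have : A (sup A + h).
  split.
    case/andP: Asup => ? ?.
    have : h <= b - sup A by near: h; apply: nbhs_right_le; rewrite subr_gt0.
    lra.
  have : f (sup A + h) <= f (sup A) + e * h by near: h.
  by move=> /le_trans; apply; rewrite -lerBrDr (le_trans fsup)//; lra.
move=> /(ub_le_sup hA.2); lra.
Unshelve. all: by end_near. Qed.

Definition expR_primitive {R : realType} (lambda t : R) : R :=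
  if lambda == 0 then t else expR (lambda * t) / lambda.

Lemma is_derive_expRM {R : realType} (lambda t : R) :
  is_derive t 1 (fun r => expR (lambda * r)) (lambda * expR (lambda * t)).
Proof.
rewrite mulrC; apply: (@is_derive1_comp _ expR (fun r => lambda * r)).
by apply: is_derive_eq; rewrite /GRing.scale /= mulr1.
Qed.

Lemma is_derive_expR_primitive {R : realType} (lambda t : R) :
  is_derive t 1 (expR_primitive lambda) (expR (lambda * t)).
Proof.
rewrite /expR_primitive; have [->|l0] := eqVneq lambda 0.
  by rewrite mul0r expR0; apply: is_derive_id.
have := is_derive_expRM lambda t => h.
rewrite (_ : (fun r => _) = lambda^-1 *: (fun r => expR (lambda * r))); last first.
  by apply/funext => r; rewrite /= mulrC.
by apply: is_derive_eq; rewrite /GRing.scale /=; field.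
Qed.

Lemma continuous_expRM {R : realType} (lambda : R) :
  continuous (fun r => expR (lambda * r)).
Proof.
move=> x; apply: differentiable_continuous; apply/derivable1_diffP.
by have [] := is_derive_expRM lambda x.
Qed.

Lemma continuous_expR_primitive {R : realType} (lambda : R) :
  continuous (expR_primitive lambda).
Proof.
move=> x; apply: differentiable_continuous; apply/derivable1_diffP.
by have [] := is_derive_expR_primitive lambda x.
Qed.

(** Converts e^(lambda t) - 1, the excess of the weight at time t over the
    weight at time 0, into lambda E_lambda(t): this is where the lambda term of
    the convexity inequality comes from. *)
Lemma expR_primitiveE {R : realType} (lambda t : R) :
  lambda * (expR_primitive lambda t - expR_primitive lambda 0)
  = expR (lambda * t) - 1.
Proof.
rewrite /expR_primitive; have [->|l0] := eqVneq lambda 0.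
  by rewrite !mul0r expR0 subrr.
by rewrite mulr0 expR0; field.
Qed.

Lemma E_E {R : realType} (lambda t : R) : 0 < t ->
  E_ lambda t = expR_primitive lambda t - expR_primitive lambda 0.
Proof.
move=> t0.
have c := continuous_expRM lambda.
have cA := continuous_expR_primitive lambda.
rewrite /E_ /Rintegral
  (@continuous_FTC2 _ (fun r => expR (lambda * r)) (expR_primitive lambda))//.
- exact: continuous_subspaceT.
- split => [x _||].
  + by have [] := is_derive_expR_primitive lambda x.
  + by apply: cvg_at_right_filter; exact: cA.
  + by apply: cvg_at_left_filter; exact: cA.
- by move=> x _; rewrite derive1E; have [_ ->] := is_derive_expR_primitive lambda x.
Qed.

Lemma E_gt0 {R : realType} (lambda t : R) : 0 < t -> 0 < E_ lambda t.
Proof.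
move=> t0; rewrite E_E//; have := expR_primitiveE lambda t.
have [l0|l0|->] := ltgtP lambda 0; last first.
- by rewrite /expR_primitive eqxx subr0.
- move=> h; have : 1 < expR (lambda * t) by rewrite expR_gt1 mulr_gt0.
  by rewrite -subr_gt0 -h pmulr_rgt0.
- move=> h; have : expR (lambda * t) < 1 by rewrite expR_lt1 pmulr_llt0.
  by rewrite -subr_lt0 -h nmulr_rlt0.
Qed.

Lemma upper_right_derivative_le_near {R : realType} (zeta : R -> R) (t c e : R) :
  (upper_right_derivative zeta t <= c%:E)%E -> 0 < e ->
  \forall h \near 0^'+, zeta (t + h) - zeta t <= h * (c + e).
Proof.
move=> Dc e0.
have : (upper_right_derivative zeta t < (c + e)%:E)%E.
  by rewrite (le_lt_trans Dc)// lte_fin ltrDl.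
rewrite /upper_right_derivative limf_esupE => /ereal_inf_lt[_ [V V0 <-] hV].
near=> h.
have h0 : 0 < h by [].
have Vh : V h by near: h; exact: V0.
have : (((zeta (t + h) - zeta t) / h)%:E < (c + e)%:E)%E.
  by apply: le_lt_trans hV; apply: ereal_sup_ubound; exists h.
by rewrite lte_fin ltr_pdivrMr// => /ltW; rewrite mulrC.
Unshelve. all: by end_near. Qed.

(** Gronwall-type integration of zeta' <= K - lambda zeta: the function
    psi r = e^(lambda r) zeta r - K A(r), where A is a primitive of
    e^(lambda r), has non-positive upper right derivative. The inequality is
    not available at r = 0, so psi is first compared on [d, t], and d then
    decreases to 0. *)
Lemma Dini_linear_inequality {R : realType} (zeta : R -> R) (lambda K t : R) :
  0 < t ->
  {in `]0, t], continuous zeta} -> zeta r @[r --> 0^'+] --> zeta 0 ->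
  (forall r, 0 < r < t ->
     (upper_right_derivative zeta r <= (K - lambda * zeta r)%:E)%E) ->
  expR (lambda * t) * zeta t - zeta 0 <= K * E_ lambda t.
Proof.
move=> t0 cz z0 Dz.
pose psi r := expR (lambda * r) * zeta r - K * expR_primitive lambda r.
have cexp := continuous_expRM lambda.
have cA := continuous_expR_primitive lambda.
suff h : psi t <= psi 0.
  move: h; rewrite /psi mulr0 expR0 mul1r E_E//; lra.
have psi0 : psi r @[r --> 0^'+] --> psi 0.
  apply: cvgB; first apply: cvgM => //.
    by apply: cvg_at_right_filter; exact: cexp.
  by apply: cvgM; [exact: cvg_cst | apply: cvg_at_right_filter; exact: cA].
suff h : \forall d \near 0^'+, psi t <= psi d.
  exact: cvgr_to_ge psi0 h.
near=> d.
have d0 : 0 < d by [].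
have dt : d <= t by near: d; exact: nbhs_right_le.
apply: Dini_nonincreasing => //.
- move=> r; rewrite in_itv /= => /andP[dr rt].
  apply: cvgB; last by apply: cvgM; [exact: cvg_cst | exact: cA].
  apply: cvgM; first exact: cexp.
  by apply: cz; rewrite in_itv /= rt andbT (lt_le_trans d0).
- move=> r /andP[dr rt] e e0.
  pose c := K - lambda * zeta r.
  pose e' := e / (2 * expR (lambda * r)).
  have x0 := expR_gt0 (lambda * r).
  have e'0 : 0 < e' by rewrite divr_gt0// mulr_gt0.
  (* g h bounds the difference quotient of psi at r; e' is chosen so that g
     tends to e / 2. *)
  pose g h := expR (lambda * (r + h)) * (c + e')
     + zeta r * (h^-1 * (expR (lambda * (r + h)) - expR (lambda * r)))
     - K * (h^-1 * (expR_primitive lambda (r + h) - expR_primitive lambda r)).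
  have dq f l : is_derive r 1 f l ->
      h^-1 * (f (r + h) - f r) @[h --> (0 : R)^'+] --> l.
    move=> [df <-]; apply: cvg_dnbhs_at_right.
    rewrite [X in X @ _ --> _](_ : _ =
        fun h => h^-1 *: ((f \o shift r) (h *: 1) - f r)); first exact: df.
    by apply/funext => h; rewrite /= [in RHS]/GRing.scale /= mulr1 [h + r]addrC.
  have cg : g h @[h --> 0^'+] --> expR (lambda * r) * (c + e')
      + zeta r * (lambda * expR (lambda * r)) - K * expR (lambda * r).
    apply: cvgB; last first.
      apply: cvgM; first exact: cvg_cst.
      exact/dq/is_derive_expR_primitive.
    apply: cvgD; last first.
      apply: cvgM; first exact: cvg_cst.
      exact: (dq (fun x => expR (lambda * x)) _ (is_derive_expRM lambda r)).
    apply: cvgM; last exact: cvg_cst.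
    apply: cvg_at_right_filter.
    have : r + x @[x --> 0] --> r + 0 by apply: cvgD; [exact: cvg_cst|exact: cvg_id].
    by rewrite addr0 => h; apply: (cvg_comp _ _ h (cexp r)).
  have ge : expR (lambda * r) * (c + e')
      + zeta r * (lambda * expR (lambda * r)) - K * expR (lambda * r) < e.
    have -> : expR (lambda * r) * (c + e')
      + zeta r * (lambda * expR (lambda * r)) - K * expR (lambda * r) = e / 2.
      by rewrite /c /e'; field; rewrite gt_eqF.
    lra.
  have r0 : 0 < r < t by rewrite (lt_le_trans d0 dr) rt.
  have hz := upper_right_derivative_le_near zeta r c e' (Dz r r0) e'0.
  near=> h.
  have h0 : 0 < h by [].
  have gh : g h <= e by near: h; apply: (cvgr_le _ cg).
  have hz' : zeta (r + h) - zeta r <= h * (c + e') by near: h; exact: hz.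
  have xh := expR_gt0 (lambda * (r + h)).
  have : h * g h <= e * h by rewrite mulrC ler_pM2r.
  have -> : h * g h = expR (lambda * (r + h)) * (h * (c + e'))
     + zeta r * (expR (lambda * (r + h)) - expR (lambda * r))
     - K * (expR_primitive lambda (r + h) - expR_primitive lambda r).
    by rewrite /g; field; rewrite gt_eqF.
  have : expR (lambda * (r + h)) * (zeta (r + h) - zeta r) <=
         expR (lambda * (r + h)) * (h * (c + e')) by rewrite ler_pM2l.
  rewrite /psi; lra.
Unshelve. all: by end_near. Qed.

(** * Consequences of the evolution variational inequality *)

Lemma metric_dist_cvg {R : realType} {X : metricType R} {T : Type}
    {F : set_system T} {FF : Filter F} (f : T -> X) (x v : X) :
  f @ F --> x -> mdist (f y) v @[y --> F] --> mdist x v.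
Proof.
move=> fx; apply/cvgrPdist_lt => e e0.
have near_x := metricType_numDomainType.cvgr_dist_lt fx e0.
near=> y.
have hy : mdist x (f y) < e by near: y; exact: near_x.
have h1 := metric_triangle x (f y) v; have h2 := metric_triangle (f y) x v.
move: h2; rewrite (metric_sym (f y) x) => h2.
rewrite ltr_norml; apply/andP; split; lra.
Unshelve. all: by end_near. Qed.

(** For r in ]0, t[ the energy F (S r u) is at least F (S t u), which turns
    the evolution variational inequality into a linear differential inequality
    with a constant right-hand side. *)
Lemma integrated_EVI {R : realType} {X : metricType R} {F : X -> \bar R}
    {lambda : R} {S : R -> X -> X} (u v : X) (t : R) :
  (forall x, (-oo < F x)%E) -> lambda_flow F lambda S ->
  proper_domain F v -> 0 < t ->
  expR (lambda * t) * mdist (S t u) v ^+ 2 - mdist u v ^+ 2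
    <= 2 * (fine (F v) - fine (F (S t u))) * E_ lambda t.
Proof.
move=> FNy hF Fv t0.
have hS := lambda_flow_semigroup hF.
have finF x : proper_domain F x -> (fine (F x))%:E = F x.
  by move=> Fx; rewrite fineK// fin_real// FNy.
have := @Dini_linear_inequality R (fun r => mdist (S r u) v ^+ 2) lambda
   (2 * (fine (F v) - fine (F (S t u)))) t t0.
rewrite (C0_semigroup0 hS); apply.
- move=> r; rewrite in_itv /= => /andP[r0 _].
  have h : mdist (S y u) v @[y --> r] --> mdist (S r u) v.
    exact: (metric_dist_cvg _ _ _ (C0_semigroup_orbit_continuous u r hS r0)).
  exact: (cvgM h h).
- rewrite -[u in X in _ --> X](C0_semigroup0 hS).
  have h : mdist (S y u) v @[y --> 0^'+] --> mdist (S 0 u) v.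
    exact: (metric_dist_cvg (S^~ u) _ _ (C0_semigroup_cvg0 hS (u := u))).
  exact: (cvgM h h).
move=> r /andP[r0 rt].
have Fr := lambda_flow_domain hF u r0.
have Ft := lambda_flow_domain hF u t0.
have := lambda_flow_EVI hF Fv (ltW r0) Fr.
have : (F (S t u) <= F (S r u))%E.
  by apply: (lambda_flow_nonincreasing hF); rewrite ?in_itv /= ?andbT// ltW.
rewrite -(finF _ Fr) -(finF _ Ft) -(finF _ Fv) lee_fin /=.
(* A derivative equal to +oo would contradict the inequality; -oo satisfies any
   upper bound. *)
case: upper_right_derivative => [D||] //=.
- rewrite -!EFinM -!EFinD !lee_fin; lra.
- by rewrite mulry gtr0_sg ?invr_gt0// mul1e.
- by rewrite leNye.
Qed.

(** A flow is only assumed to decrease the energy at positive times; the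
    comparison with time 0 is the integrated inequality with v = u. *)
Lemma flow_energy_le {R : realType} {X : metricType R} {F : X -> \bar R}
    {lambda : R} {S : R -> X -> X} (u : X) (t : R) :
  (forall x, (-oo < F x)%E) -> lambda_flow F lambda S -> 0 < t ->
  (F (S t u) <= F u)%E.
Proof.
move=> FNy hF t0.
have [Fu|] := ltP (F u) +oo%E; last by move=> /(le_trans _); apply; rewrite leey.
have := integrated_EVI u u t FNy hF Fu t0.
rewrite mdistxx expr0n /= subr0 => h.
have Ft := lambda_flow_domain hF u t0.
rewrite -(@fineK _ (F u)) ?fin_real ?FNy// -(@fineK _ (F (S t u))) ?fin_real ?FNy//.
have : 0 <= 2 * (fine (F u) - fine (F (S t u))) * E_ lambda t.
  by apply: le_trans h; rewrite mulr_ge0 ?expR_ge0// sqr_ge0.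
by rewrite pmulr_lge0 ?E_gt0// pmulr_rge0// subr_ge0 lee_fin.
Qed.

(** The algebra of the argument. Here X = e^(lambda t) and E = E_lambda(t);
    a and b are the distances from S_t (gamma s) to the two ends of the curve,
    p and q those from gamma s, D the distance between the ends; f, f0 and f1
    are the energies of S_t (gamma s) and of the ends. *)
Lemma convexity_from_EVI {R : realType} {lambda X E s a b p q D L eps f f0 f1 : R} :
  0 < E -> lambda * E = X - 1 -> 0 < X -> 0 <= s <= 1 -> 0 <= D ->
  0 <= p -> 0 <= q ->
  D <= a + b -> p <= L * s -> q <= L * (1 - s) -> L ^+ 2 <= D ^+ 2 + eps ^+ 2 ->
  X * a ^+ 2 - p ^+ 2 <= 2 * (f0 - f) * E ->
  X * b ^+ 2 - q ^+ 2 <= 2 * (f1 - f) * E ->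
  f <= (1 - s) * f0 + s * f1 - lambda / 2 * s * (1 - s) * D ^+ 2
       + eps ^+ 2 / (2 * E) * s * (1 - s).
Proof.
move=> E0 XE X0 /andP[s0 s1] D0 p0 q0 Dab pL qL Leps EVI0 EVI1.
have s1' : 0 <= 1 - s by lra.
have ss : 0 <= s * (1 - s) by rewrite mulr_ge0.
have D2 : D ^+ 2 <= (a + b) ^+ 2 by rewrite ler_sqr ?nnegrE// (le_trans D0).
have p2 : p ^+ 2 <= (L * s) ^+ 2 by rewrite ler_sqr ?nnegrE// (le_trans p0).
have q2 : q ^+ 2 <= (L * (1 - s)) ^+ 2 by rewrite ler_sqr ?nnegrE// (le_trans q0).
have ab : s * (1 - s) * D ^+ 2 <= (1 - s) * a ^+ 2 + s * b ^+ 2.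
  apply: (le_trans (ler_wpM2l ss D2)); rewrite -subr_ge0.
  rewrite (_ : _ - _ = ((1 - s) * a - s * b) ^+ 2) ?sqr_ge0//; ring.
have h0 := ler_wpM2l s1' EVI0.
have h1 := ler_wpM2l s0 EVI1.
have h2 := ler_wpM2l s1' p2.
have h3 := ler_wpM2l s0 q2.
have h4 := ler_wpM2l (ltW X0) ab.
have h5 := ler_wpM2l ss Leps.
rewrite -(ler_pM2r (x := 2 * E)) ?mulr_gt0//.
have -> : ((1 - s) * f0 + s * f1 - lambda / 2 * s * (1 - s) * D ^+ 2
   + eps ^+ 2 / (2 * E) * s * (1 - s)) * (2 * E) =
   2 * ((1 - s) * f0 + s * f1) * E - (X - 1) * s * (1 - s) * D ^+ 2
   + eps ^+ 2 * s * (1 - s).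
  by rewrite -XE; field; rewrite gt_eqF.
lra.
Qed.

(** At s = 0 and s = 1 the estimate is the decrease of the energy, and only the
    energy of one end has to be finite; for 0 < s < 1 an infinite energy at
    either end makes the right-hand side infinite. *)
Lemma flow_almost_convex {R : realType} {X : metricType R} {F : X -> \bar R}
    {lambda : R} {S : R -> X -> X} {gamma : R -> X} {L eps t s : R} :
  (forall x, (-oo < F x)%E) -> lambda_flow F lambda S ->
  lipschitz_curve L gamma ->
  L ^+ 2 <= mdist (gamma 0) (gamma 1) ^+ 2 + eps ^+ 2 ->
  0 < t -> s \in `[0, 1] ->
  (F (S t (gamma s))
     <= (1 - s)%:E * F (gamma 0%R) + s%:E * F (gamma 1%R)
        - (lambda / 2 * s * (1 - s)
             * mdist (gamma 0%R) (gamma 1%R) ^+ 2)%:E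
        + (eps ^+ 2 / (2 * E_ lambda t) * s * (1 - s))%:E)%E.
Proof.
move=> FNy hF gammaL Leps t0 s01.
rewrite -addeA -EFinN -EFinD; set k := (X in (_ <= _ + X%:E)%E).
have := s01; rewrite in_itv /= => /andP[].
rewrite le_eqVlt => /predU1P[s0 _|s0].
  have -> : k = 0 by rewrite /k -s0 !(mulr0, mul0r) oppr0 addr0.
  by rewrite -s0 subr0 mul1e mul0e !adde0; exact: (flow_energy_le _ _ FNy hF t0).
rewrite le_eqVlt => /predU1P[s1|s1].
  have -> : k = 0 by rewrite /k s1 subrr !(mulr0, mul0r) oppr0 addr0.
  by rewrite s1 subrr mul1e mul0e add0e adde0; exact: (flow_energy_le _ _ FNy hF t0).
have s1' : 0 < 1 - s by rewrite subr_gt0.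
have dom x y : F (gamma x) = y%:E -> proper_domain F (gamma x).
  by rewrite /proper_domain /= => ->; rewrite ltry.
move: (FNy (gamma 0)) (FNy (gamma 1)).
case F0E : (F (gamma 0)) => [f0||] //; case F1E : (F (gamma 1)) => [f1||] // _ _.
- have F0 := dom _ _ F0E; have F1 := dom _ _ F1E.
  have Ft := lambda_flow_domain hF (gamma s) t0.
  rewrite -(@fineK _ (F (S t _))) ?fin_real ?FNy//.
  rewrite -!EFinM -!EFinD lee_fin /k addrA.
  have I0 := integrated_EVI (gamma s) _ t FNy hF F0 t0.
  have I1 := integrated_EVI (gamma s) _ t FNy hF F1 t0.
  move: I0 I1; rewrite F0E F1E /=.
  have i0 : (0 : R) \in `[0, 1] by rewrite in_itv /= lexx ler01.
  have i1 : (1 : R) \in `[0, 1] by rewrite in_itv /= lexx ler01.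
  apply: (convexity_from_EVI (L := L)) => //; rewrite ?expR_gt0 ?E_gt0 ?mdist_ge0//.
  + by rewrite E_E// expR_primitiveE.
  + by rewrite (metric_sym (S t _)) metric_triangle.
  + by rewrite (le_trans (gammaL _ _ s01 i0))// subr0 gtr0_norm.
  + by rewrite (le_trans (gammaL _ _ s01 i1))// distrC gtr0_norm.
- by rewrite gt0_muley ?lte_fin// addey// addye// leey.
- by rewrite gt0_muley ?lte_fin// !addye// leey.
- by rewrite !gt0_muley ?lte_fin// !addye// leey.
Qed.

Theorem theorem3p2 (R : realType) (X : metricType R) (F : X -> \bar R)
    (lambda : R) (S : R -> X -> X)
    (F_gtNy : forall x, (-oo < F x)%E)
    (F_lsc : lower_semicontinuous F)
    (F_bounded_below : exists m : R, forall x, (m%:E <= F x)%E)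
    (F_dense : dense (proper_domain F))
    (S_flow : lambda_flow F lambda S) :
  (forall (gamma : R -> X) (L eps : R),
     0 <= L -> 0 <= eps ->
     lipschitz_curve L gamma ->
     L ^+ 2 <= mdist (gamma 0) (gamma 1) ^+ 2 + eps ^+ 2 ->
     forall t s : R, 0 < t -> s \in `[0, 1] ->
     (F (S t (gamma s))
        <= (1 - s)%:E * F (gamma 0%R) + s%:E * F (gamma 1%R)
           - (lambda / 2 * s * (1 - s)
                * mdist (gamma 0%R) (gamma 1%R) ^+ 2)%:E
           + (eps ^+ 2 / (2 * E_ lambda t) * s * (1 - s))%:E)%E)
  /\ strongly_geodesically_convex lambda F.
Proof.
split=> [gamma L eps _ _ gammaL Leps t s t0 s01|gamma geo s s01].
  exact: (flow_almost_convex F_gtNy S_flow gammaL Leps t0 s01).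
set c := (X in (_ <= X)%E).
have Fc t : 0 < t -> (F (S t (gamma s)) <= c)%E.
  move=> t0.
  have := flow_almost_convex (eps := 0) F_gtNy S_flow geo _ t0 s01.
  by rewrite expr0n /= !mul0r addr0 adde0; apply.
case: c Fc => [r||] Fc; last 2 first.
- by rewrite leey.
- by have := Fc 1 ltr01; rewrite leeNy_eq gt_eqF.
(* A value of F (gamma s) above r would persist, by lower semicontinuity, at
   S_t (gamma s) for small t > 0. *)
rewrite leNgt; apply/negP => /F_lsc[V nV VF].
have hS := lambda_flow_semigroup S_flow.
have S0 := C0_semigroup_cvg0 hS (u := gamma s).
near (0 : R)^'+ => t.
have t0 : 0 < t by [].
have /VF : V (S t (gamma s)) by near: t; apply: S0; rewrite (C0_semigroup0 hS).
by rewrite ltNge Fc.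
Unshelve. all: by end_near. Qed.
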